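(* For any Tychonoff space $X$ the following conditions are equivalent: (i) $X$ is compact; (ii) $C_p(X)$ is linearly Eberlein-Grothendieck; (iii) $(C_k(X), w)$ is linearly Eberlein-Grothendieck.
   Context: All topological spaces are assumed to be Tychonoff and all vector spaces are over $\mathbb{R}$. $C_k(X)$ (resp. $C_p(X)$) is the space $C(X)$ of continuous real-valued functions on $X$ with the compact-open topology (resp. the topology of pointwise convergence). For a locally convex space $E$, $(E,w)$ denotes $E$ with its weak topology $w=\sigma(E,E^{\ast})$, where $E^{\ast}$ is the space of continuous linear functionals on $E$. A locally convex space $H$ is linearly Eberlein-Grothendieck if $H$ is linearly isomorphic (i.e. linearly homeomorphic) to a linear subspace of $C_p(K)$ for some compact space $K$. *)

(* Defs.v *)
From HB Require Import structures.
From mathcomp Require Import all_boot all_order all_algebra.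
From mathcomp Require Import all_classical all_reals all_analysis.

Set Implicit Arguments.
Unset Strict Implicit.
Unset Printing Implicit Defensive.

Import Order.TTheory GRing.Theory Num.Theory.
Import numFieldNormedType.Exports.

Local Open Scope classical_set_scope.
Local Open Scope ring_scope.

Definition tychonoff_space (X : topologicalType) : Prop :=
  hausdorff_space X /\ completely_regular_space X.

Section continuous_lmodule.
Variables (R : realType) (X : topologicalType).
Local Notation C := (continuousType X R^o).
Implicit Types (f g h : C) (a b : R).

Let cts0 : continuous (cst 0 : X -> R^o).
Proof. by move=> x; exact: cvg_cst. Qed.

Let ctsN f : continuous (\- f).
Proof. by move=> x; apply: cvgN; exact: cts_fun. Qed.

Let ctsD f g : continuous (f \+ g).
Proof. by move=> x; apply: cvgD; exact: cts_fun. Qed.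

Let ctsZ a f : continuous (a \*: f).
Proof. by move=> x; apply: cvgZl_tmp; exact: cts_fun. Qed.

Definition cts_zero : C := mkcts cts0.
Definition cts_opp f : C := mkcts (ctsN (f := f)).
Definition cts_add f g : C := mkcts (ctsD (f := f) (g := g)).
Definition cts_scale a f : C := mkcts (ctsZ (a := a) (f := f)).

Let cts_addA : associative cts_add.
Proof. by move=> f g h; apply/continuousEP => x; exact: addrA. Qed.

Let cts_addC : commutative cts_add.
Proof. by move=> f g; apply/continuousEP => x; exact: addrC. Qed.

Let cts_add0 : left_id cts_zero cts_add.
Proof. by move=> f; apply/continuousEP => x; exact: add0r. Qed.

Let cts_addN : left_inverse cts_zero cts_opp cts_add.
Proof. by move=> f; apply/continuousEP => x; exact: addNr. Qed.

HB.instance Definition _ :=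
  GRing.isZmodule.Build C cts_addA cts_addC cts_add0 cts_addN.

Let cts_scaleA a b f : cts_scale a (cts_scale b f) = cts_scale (a * b) f.
Proof. by apply/continuousEP => x; exact: scalerA. Qed.

Let cts_scale1 : left_id 1 cts_scale.
Proof. by move=> f; apply/continuousEP => x; exact: scale1r. Qed.

Let cts_scaleDr : right_distributive cts_scale +%R.
Proof. by move=> a f g; apply/continuousEP => x; exact: scalerDr. Qed.

Let cts_scaleDl f : {morph cts_scale^~ f : a b / a + b}.
Proof. by move=> a b; apply/continuousEP => x; exact: scalerDl. Qed.

HB.instance Definition _ := GRing.Zmodule_isLmodule.Build R C
  cts_scaleA cts_scale1 cts_scaleDr cts_scaleDl.

End continuous_lmodule.

(* Aliases of the vector space C(X), so that each carries its own topology. *)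
Definition Cp (R : realType) (X : topologicalType) : Type :=
  continuousType X R^o.
Definition Ck (R : realType) (X : topologicalType) : Type :=
  continuousType X R^o.

HB.instance Definition _ (R : realType) (X : topologicalType) :=
  GRing.Lmodule.copy (Cp R X) (continuousType X R^o).
HB.instance Definition _ (R : realType) (X : topologicalType) :=
  Topological.copy (Cp R X)
    (initial_topology (id : continuousType X R^o -> {ptws X -> R^o})).

HB.instance Definition _ (R : realType) (X : topologicalType) :=
  GRing.Lmodule.copy (Ck R X) (continuousType X R^o).
HB.instance Definition _ (R : realType) (X : topologicalType) :=
  Topological.copy (Ck R X)
    (initial_topology (id : continuousType X R^o -> {compact-open, X -> R^o})).

Definition dual (R : realType) (E : preTopologicalLmodType R) : Type :=
  {f : {linear E -> R^o} | continuous f}.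

(* E with the topology sigma(E, dual E), the coarsest one making every element
   of the dual continuous. *)
Definition weak (R : realType) (E : preTopologicalLmodType R) : Type := E.

HB.instance Definition _ (R : realType) (E : preTopologicalLmodType R) :=
  GRing.Lmodule.copy (weak E) E.
HB.instance Definition _ (R : realType) (E : preTopologicalLmodType R) :=
  Topological.copy (weak E)
    (sup_topology (fun f : dual E =>
      Topological.class (initial_topology (sval f : E -> R^o)))).

(* T is a linear homeomorphism from H onto the linear subspace L of E, where L
   has the topology induced by E; S, of which only the values on L matter, is
   its inverse. *)
Definition linear_homeomorphism_onto (R : realType)
    (H E : preTopologicalLmodType R) (L : set E) (T : {linear H -> E}) : Prop :=
  exists S : E -> H,
    [/\ forall h, L (T h), cancel T S, {in L, cancel S T},
        continuous T & {within L, continuous S}].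

Definition linearly_Eberlein_Grothendieck (R : realType)
    (H : preTopologicalLmodType R) : Prop :=
  exists K : topologicalType,
    [/\ tychonoff_space K, compact [set: K] &
      exists (L : set (Cp R K)) (T : {linear H -> Cp R K}),
        GRing.submod_closed [in L] /\ linear_homeomorphism_onto L T].

(* Main.v *)
From HB Require Import structures.
Require Import Defs.
From mathcomp Require Import all_boot all_order all_algebra.
From mathcomp Require Import all_classical all_reals all_analysis.
From mathcomp Require Import lra.

(** If [X] is compact, the identity embeds [Cp X] into [Cp X] itself, and
    evaluation embeds [C(X)] with its weak topology into [Cp K], where [K] is
    the unit ball of the dual of the Banach space [C(X)] with the weak-star
    topology: [K] is compact by Tychonoff's theorem ([compact_dual_ball]), and
    since it absorbs every continuous functional, the topology of pointwise
    convergence on [K] is the weak one ([weak_Ck_linearly_EG_of_compact]).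

    The converses are two instances of [compact_of_linearly_EG].  Both
    topologies on [C(X)] are coarser than the compact-open topology and make
    the evaluations at the points of [X] continuous.  So an embedding [T] into
    [Cp K] has two properties, by continuity of [T] and of its inverse:
    - for each [k] in [K], the functional [f |-> T f k] depends only on the
      restriction of [f] to some compact subset of [X];
    - for each [x] in [X], smallness of [T f] at finitely many points of [K]
      forces [`|f x| < 1].
    These suffice for [X] to be compact ([compact_of_norming]).  Let [F] be a
    proper filter on [X] without cluster point, and let [X_n] be the set of
    those [x] for which the second property holds with [n] points of [K] and
    the bound [1 / (n + 1)]; these sets cover [X].  By complete regularity, for
    every compact subset of [X] some continuous function into [[0, 1]] vanishes
    on it and equals [1] on a member of [F].  By compactness of the powers of
    [K], finitely many such functions have a minimum [q_n] that is smaller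
    than [1] everywhere on [X_n], while it is [1] on a member of [F].  The
    open sets where [q_i > 1 - 1 / (n + 1)] for all [i < n] are nonempty and
    form, as [n] varies, a locally finite family.  So, if [h_n] is continuous
    and nonzero exactly on the [n]-th of them, every series in the [h_n], with
    arbitrary coefficients, has a continuous sum.  A gliding hump argument
    ([gliding_hump]) chooses the coefficients so that the image under [T] of
    the sum is unbounded on [K], although it is continuous and [K] is
    compact. *)

Set Implicit Arguments.
Unset Strict Implicit.
Unset Printing Implicit Defensive.

Import Order.TTheory GRing.Theory Num.Theory.
Import numFieldNormedType.Exports.

Local Open Scope classical_set_scope.
Local Open Scope ring_scope.

(** * Compactness and locally finite families *)

(** Compactness in the form in which it is used throughout: a property of sets
    that is stable under subsets and finite unions passes from small
    neighbourhoods to the whole of a compact set.  If it failed, the sets whose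
    complement in [Q] has the property would form a proper filter without
    cluster point in [Q]. *)
Lemma compact_ideal (T : topologicalType) (P : set T -> Prop) (Q : set T) :
  P set0 -> (forall A B, A `<=` B -> P B -> P A) ->
  (forall A B, P A -> P B -> P (A `|` B)) ->
  (forall x, Q x -> exists2 U, nbhs x U & P U) ->
  compact Q -> P Q.
Proof.
move=> P0 PS PU locP cQ; apply: contrapT => nPQ.
pose G : set_system T := [set A | P (Q `\` A)].
have GF : ProperFilter G.
  split; first by rewrite /G /= setD0.
  split.
  - by rewrite /G /= setDT.
  - by move=> A B GA GB; rewrite /G /= setDIr; exact: PU.
  - by move=> A B AB; apply: PS; exact: setDS.
have GQ : G Q by rewrite /G /= setDv.
have [x [Qx Gx]] := cQ G GF GQ.
have [U Ux PUx] := locP x Qx.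
have GU : G (~` U) by apply: PS PUx; rewrite setDE setCK; exact: subIsetr.
by have [y [nUy Uy]] := Gx _ _ GU Ux.
Qed.

Lemma continuous_bounded_on_compact (R : realType) (K : topologicalType)
    (f : K -> R^o) : compact [set: K] -> continuous f ->
  exists2 M : R, 0 < M & forall k, `|f k| <= M.
Proof.
move=> cK cf.
have [M M0 HM] : exists2 M : R, 0 < M & forall k, [set: K] k -> `|f k| <= M.
  apply: (@compact_ideal K (fun A => exists2 M : R, 0 < M & forall k, A k ->
    `|f k| <= M)) => //.
  - by exists 1.
  - by move=> A B AB [M M0 HM]; exists M => // k /AB; exact: HM.
  - move=> A B [M M0 HM] [M' M0' HM']; exists (Num.max M M').
      by rewrite lt_max M0.
    by move=> k; case=> [/HM|/HM'] H; rewrite le_max H ?orbT.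
  - move=> k _; exists [set k' | `|f k - f k'| < 1].
      by have /cvgrPdist_lt := cf k; apply.
    exists (`|f k| + 1); first by rewrite ltr_wpDl.
    move=> k' /=.
    have := ler_normD (f k) (f k' - f k); rewrite subrKC distrC; lra.
by exists M => // k; exact: HM.
Qed.

(** The partial sums of a locally finite series are of this kind.  The limit is
    continuous because near each point it coincides with some [S n]. *)
Lemma locally_stationary_limit (R : realType) (X : topologicalType)
    (S : nat -> continuousType X R^o) :
  (forall x : X, exists2 U, nbhs x U &
     exists N, forall n y, (N <= n)%N -> U y -> S n y = S N y) ->
  exists H : continuousType X R^o, forall x : X, exists2 U, nbhs x U &
     exists N, forall n y, (N <= n)%N -> U y -> H y = S n y.
Proof.
move=> locS.
have /choice[M HM] : forall x, exists N, forall n, (N <= n)%N -> S n x = S N x.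
  move=> x; have [U Ux [N HN]] := locS x.
  by exists N => n Nn; apply: HN => //; exact: nbhs_singleton.
pose H x := S (M x) x.
have locH (x : X) : exists2 U, nbhs x U &
    exists N, forall n y, (N <= n)%N -> U y -> H y = S n y.
  have [U Ux [N HN]] := locS x; exists U => //; exists N => n y Nn Uy.
  rewrite /H -(HM _ (maxn n (M y))) ?leq_maxr// HN//; last first.
    by rewrite (leq_trans Nn) ?leq_maxl.
  by rewrite -(HN n).
have cH : continuous (H : X -> R^o).
  move=> x; have [U Ux [N HN]] := locH x.
  rewrite /continuous_at (HN N x)//; last exact: nbhs_singleton.
  apply: (@cvg_trans _ (S N y @[y --> x])); last exact: cts_fun.
  apply: near_eq_cvg; apply: filterS Ux => y Uy /=.
  by rewrite -(HN N).
by exists (mkcts cH).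
Qed.

(** * The gliding hump *)

Section gliding_hump.
Variables (R : realType) (X : topologicalType) (K : Type).
Local Notation C := (continuousType X R^o).
Variable T : C -> K -> R.
Hypothesis linT : forall (a : R) f g k, T (a *: f + g) k = a * T f k + T g k.
Hypothesis bndT : forall f, exists M : R, forall k, `|T f k| <= M.
Hypothesis injT : forall f, (forall k, T f k = 0) -> forall x, f x = 0.
Hypothesis suppT : forall k, exists2 Q : set X, compact Q &
  forall f : C, (forall x, Q x -> f x = 0) -> T f k = 0.

(** At a given [k], almost all [T (h n) k] vanish, because [T f k] only depends
    on [f] on a compact set, which meets finitely many of the supports.  Since
    no [T (h n)] is identically zero, there are infinitely many [n] that are,
    for some [k], the last index with [T (h n) k != 0].  The coefficient of
    such an [h n] can be chosen so that the partial sum up to [n] has the value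
    [n] under [T] at [k], and later terms do not change this value.  The sum of
    the series is continuous, and its image is unbounded. *)
Lemma gliding_hump (h : nat -> C) :
  (forall n, exists x, h n x != 0) ->
  (forall x : X, exists2 U, nbhs x U &
     exists N, forall n y, (N <= n)%N -> U y -> h n y = 0) ->
  False.
Proof.
move=> h_neq0 h_lf.
have TB f g k : T (f - g) k = T f k - T g k.
  by rewrite -scaleN1r addrC linT mulN1r addrC.
have T0 k : T 0 k = 0 by rewrite -(subrr 0) TB subrr.
have Th_ev k : exists N, forall n, (N <= n)%N -> T (h n) k = 0.
  have [Q cQ TQ] := suppT k.
  have [N HN] : exists N, forall n y, (N <= n)%N -> Q y -> h n y = 0.
    apply: (@compact_ideal X (fun A => exists N, forall n y, (N <= n)%N ->
      A y -> h n y = 0)) => //.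
    - by exists 0%N.
    - by move=> A B AB [N HN]; exists N => n y Nn /AB; exact: HN.
    - move=> A B [N HN] [N' HN']; exists (maxn N N') => n y.
      by rewrite geq_max => /andP[? ?] [] ?; [exact: HN|exact: HN'].
  by exists N => n Nn; apply: TQ => x; exact: HN.
pose last_at n k := T (h n) k != 0 /\ forall m, (n < m)%N -> T (h m) k = 0.
have last_cofinal n : exists2 m, (n <= m)%N & exists k, last_at m k.
  have [k Thk] : exists k, T (h n) k != 0.
    apply: contrapT => /forallNP Th0; have [x] := h_neq0 n.
    by rewrite (injT (f := h n)) ?eqxx// => k; apply/eqP/negPn/negP/Th0.
  have [N HN] := Th_ev k.
  have ex : exists n, T (h n) k != 0 by exists n.
  have ub m : T (h m) k != 0 -> (m <= N)%N.
    by apply: contraNT; rewrite -ltnNge => /ltnW/HN ->.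
  have [m Thm mmax] := ex_maxnP ex ub.
  exists m; first exact: mmax.
  exists k; split=> // i mi; apply/eqP; apply: contraTT mi => /mmax.
  by rewrite -leqNgt.
(* chosen so that [T (coef S n *: h n + S) k = n] at the selected [k] *)
pose coef (S : C) n : R :=
  if pselect (exists k, last_at n k) is left e then
    let k := projT1 (cid e) in (n%:R - T S k) / T (h n) k
  else 0.
pose fix S n : C := if n is m.+1 then coef (S m) m *: h m + S m else 0.
have S_st N y : (forall n, (N <= n)%N -> h n y = 0) ->
    forall n, (N <= n)%N -> S n y = S N y.
  move=> hy0; elim=> [|n IH]; first by rewrite leqn0 => /eqP ->.
  rewrite leq_eqVlt => /predU1P[->//|]; rewrite ltnS => Nn.
  rewrite -IH// -[LHS]/(coef (S n) n * h n y + S n y).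
  by rewrite hy0// mulr0 add0r.
have [H HS] : exists H : C, forall x : X, exists2 U, nbhs x U &
     exists N, forall n y, (N <= n)%N -> U y -> H y = S n y.
  apply: locally_stationary_limit => x; have [U Ux [N HN]] := h_lf x.
  exists U => //; exists N => n y Nn Uy; apply: S_st => // m Nm.
  exact: HN.
have TH k : exists N, forall n, (N <= n)%N -> T H k = T (S n) k.
  have [Q cQ TQ] := suppT k.
  have [N HN] : exists N, forall n y, (N <= n)%N -> Q y -> H y = S n y.
    apply: (@compact_ideal X (fun A => exists N, forall n y, (N <= n)%N ->
      A y -> H y = S n y)) => //.
    - by exists 0%N.
    - by move=> A B AB [N HN]; exists N => n y Nn /AB; exact: HN.
    - move=> A B [N HN] [N' HN']; exists (maxn N N') => n y.
      by rewrite geq_max => /andP[? ?] [] ?; [exact: HN|exact: HN'].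
  exists N => n Nn; apply/eqP; rewrite -subr_eq0 -TB; apply/eqP.
  apply: TQ => x Qx; rewrite -[LHS]/(H x - S n x).
  by rewrite (HN n)// subrr.
have TH_last n : (exists k, last_at n k) -> exists k, T H k = n%:R.
  move=> e.
  have [k [lk TSk]] : exists k, last_at n k /\ T (S n.+1) k = n%:R.
    rewrite /= /coef; case: pselect => // e'.
    case: cid => k lk /=; exists k; split => //.
    by rewrite linT divfK ?subrK//; case: lk.
  exists k; rewrite -TSk.
  have TS_st m : (n < m)%N -> T (S m) k = T (S n.+1) k.
    elim: m => // m IH; rewrite ltnS leq_eqVlt => /predU1P[->//|nm].
    by rewrite [S m.+1]/= linT lk.2// mulr0 add0r IH.
  have [N HN] := TH k.
  by rewrite (HN (maxn N n.+1)) ?leq_maxl// TS_st// leq_maxr.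
have [M HM] := bndT H.
have [n nM en] := last_cofinal (Num.truncn `|M|).+1.
have [k Tk] := TH_last n en.
have := HM k; rewrite Tk normr_nat leNgt => /negP; apply.
have := truncnS_gt `|M|.
move=> /(le_lt_trans (ler_norm M)) /lt_le_trans; apply.
by rewrite ler_nat.
Qed.

End gliding_hump.

(** * Functions equal to one along a filter *)

Section plateaus.
Variables (R : realType) (X : topologicalType) (F : set_system X).
Hypothesis FF : ProperFilter F.
Local Notation C := (continuousType X R^o).

Definition plateau (q : C) : Prop :=
  (forall x, 0 <= q x <= 1) /\ F [set x | q x = 1].

Lemma plateau_cst1 : exists q : C, plateau q.
Proof.
have c1 : continuous (cst 1 : X -> R^o) by move=> x; exact: cvg_cst.
exists (mkcts c1); split.
  by move=> x; rewrite /mkcts /= lexx ler01.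
by apply: filterS filterT => x _.
Qed.

Lemma plateau_min (q1 q2 : C) : plateau q1 -> plateau q2 ->
  exists2 q : C, plateau q & forall x, q x <= q1 x /\ q x <= q2 x.
Proof.
move=> [q01 F1] [q02 F2].
have cq : continuous ((q1 : X -> R^o) \min (q2 : X -> R^o)).
  by move=> x; apply: continuous_min; exact: cts_fun.
exists (mkcts cq); last by move=> x; rewrite /mkcts /= !ge_min !lexx orbT.
split.
  move=> x; have /andP[a b] := q01 x; have /andP[c d] := q02 x.
  by rewrite /mkcts /= le_min a c ge_min b.
by apply: filterS2 F1 F2 => x /= e1 e2; rewrite /mkcts /= e1 e2 minxx.
Qed.

(** Each point of [Q] has a neighbourhood that avoids a member of [F], so
    complete regularity gives a plateau vanishing at that point.  Truncating
    this function makes it vanish on a neighbourhood, and a minimum of finitely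
    many of these plateaus vanishes on [Q]. *)
Lemma plateau_vanishing : completely_regular_space X -> cluster F = set0 ->
  forall Q, compact Q -> exists2 q : C, plateau q & forall x, Q x -> q x = 0.
Proof.
move=> crX F0 Q.
pose P (A : set X) := exists2 q : C, plateau q & forall x, A x -> q x = 0.
apply: (@compact_ideal X P).
- by have [q bq] := plateau_cst1; exists q.
- by move=> A B AB [q bq q0]; exists q => // x /AB; exact: q0.
- move=> A B [q bq q0] [q' bq' q0'].
  have [p bp pq] := plateau_min bq bq'; exists p => // x ABx.
  apply/eqP; rewrite eq_le; have /andP[-> _] := bp.1 x; rewrite andbT.
  have [pq1 pq2] := pq x.
  by case: ABx => [/q0 <-|/q0' <-].
- move=> y _; have : ~ cluster F y by rewrite F0.
  move=> /existsNP[A /existsNP[B /not_implyP[FA]]].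
  move=> /not_implyP[By /nonemptyPn AB0].
  have [//||f [cf f01 fy fB]] :=
    (@uniform_separatorP X R [set y] (~` B^°)).1 (crX y (~` B^°) _ _).
  - by apply: open_closedC; exact: open_interior.
  - by move=> /=; apply; exact: By.
  have fx x : 0 <= f x <= 1.
    by have := f01 (f x) (ex_intro2 _ _ x I erefl); rewrite /= in_itv.
  (* zero where [f <= 1 / 2], hence near [y], and one where [f] is *)
  have cq : continuous ((fun x => Num.max 0 (2 * f x - 1)) : X -> R^o).
    move=> x; apply: (@continuous_max _ _ (cst 0) (fun x => 2 * f x - 1)).
      exact: cvg_cst.
    apply: cvgB; last exact: cvg_cst.
    by apply: cvgM; [exact: cvg_cst|exact: cf].
  exists (f @^-1` [set t | t < 1 / 2]).
    apply: cf; rewrite (fy (f y)); last by exists y.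
    by apply: lt_nbhsl; lra.
  exists (mkcts cq).
    split.
      move=> x; rewrite /mkcts /= le_max lexx ge_max ler01 /=.
      by have := fx x; lra.
    apply: filterS FA => x Ax /=; rewrite /mkcts.
    have -> : f x = 1.
      apply: (fB (f x)); exists x => // /interior_subset Bx.
      by have : (A `&` B) x by []; rewrite AB0.
    by rewrite max_r; lra.
  by move=> x /= fx2; rewrite /mkcts max_l//; lra.
Qed.

End plateaus.

(** * A compactness criterion *)

Lemma superlevel_intersection (R : realType) (X : topologicalType)
    (q : nat -> continuousType X R^o) (t : R) (m : nat) :
  exists h : continuousType X R^o,
    forall x, h x != 0 <-> forall i, (i < m)%N -> t < q i x.
Proof.
elim: m => [|m [h hP]].
  have c1 : continuous (cst 1 : X -> R^o) by move=> x; exact: cvg_cst.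
  by exists (mkcts c1) => x; rewrite /mkcts /= oner_neq0.
have ch : continuous ((fun x => h x * Num.max 0 (q m x - t)) : X -> R^o).
  move=> x; apply: cvgM; first exact: cts_fun.
  apply: (@continuous_max _ _ (cst 0) (fun x => q m x - t)).
    exact: cvg_cst.
  by apply: cvgB; [exact: cts_fun|exact: cvg_cst].
exists (mkcts ch) => x; rewrite /mkcts /= mulf_eq0 negb_or.
have maxE : (Num.max 0 (q m x - t) != 0) = (t < q m x).
  rewrite maxElt subr_gt0; case: ifP => tq; last by rewrite eqxx.
  by rewrite subr_eq0 gt_eqF.
rewrite maxE; split=> [/andP[/hP hx tx] i|tx].
  by rewrite ltnS leq_eqVlt => /predU1P[->//|]; exact: hx.
by rewrite tx// andbT; apply/hP => i im; apply: tx; exact: ltnW.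
Qed.

Section norming.
Variables (R : realType) (X K : topologicalType).
Local Notation C := (continuousType X R^o).
Variable T : C -> K -> R.
Hypothesis crX : completely_regular_space X.
Hypothesis cK : compact [set: K].
Hypothesis linT : forall (a : R) f g k, T (a *: f + g) k = a * T f k + T g k.
Hypothesis ctsT : forall f, continuous (T f : K -> R^o).
Hypothesis suppT : forall k, exists2 Q : set X, compact Q &
  forall f : C, (forall x, Q x -> f x = 0) -> T f k = 0.
Hypothesis normT : forall x, exists ks : seq K, exists2 e : R, 0 < e &
  forall f : C, (forall k, k \in ks -> `|T f k| < e) -> `|f x| < 1.

Let TZ a f k : T (a *: f) k = a * T f k.
Proof.
have T0 : T 0 k = 0.
  by have := linT (-1) 0 0 k; rewrite scaler0 addr0 mulN1r addNr.
by rewrite -[a *: f]addr0 linT T0 addr0.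
Qed.

Let bndT f : exists M : R, forall k, `|T f k| <= M.
Proof.
by have [M _ HM] := continuous_bounded_on_compact cK (@ctsT f); exists M.
Qed.

Let injT f : (forall k, T f k = 0) -> forall x, f x = 0.
Proof.
move=> Tf0 x; have [ks [e e0 He]] := normT x.
apply/eqP/negPn/negP => fx0.
have : `|((f x)^-1 *: f) x| < 1.
  by apply: He => k _; rewrite TZ Tf0 mulr0 normr0.
by rewrite -[((f x)^-1 *: f) x]/((f x)^-1 * f x) mulVf// normr1 ltxx.
Qed.

(* A single [n] bounds both the number of points of [K] and the inverse of the
   radius, and [ks] is infinite, so that all [n] share the compact space of
   sequences in [K]. *)
Let normed_by n (ks : nat -> K) x := forall f : C,
  (forall i, (i < n)%N -> `|T f (ks i)| < n.+1%:R^-1) -> `|f x| < 1.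

Let normed_by_some x : exists n ks, normed_by n ks x.
Proof.
have [ks [e e0 He]] := normT x.
(* [ks] is nonempty: the constant function [1] is not small at [x] *)
have [k0 _] : exists k0, k0 \in ks.
  case: ks He => [He|k0 ks _]; last by exists k0; exact: mem_head.
  have c1 : continuous (cst 1 : X -> R^o) by move=> y; exact: cvg_cst.
  have : `|(mkcts c1 : C) x| < 1 by apply: He.
  by rewrite /mkcts /= normr1 ltxx.
pose n := maxn (size ks) (Num.truncn e^-1).
exists n, (nth k0 ks) => f Hf; apply: He => k kks.
have := Hf (index k ks); rewrite nth_index//.
move=> /(_ _)/lt_le_trans; apply.
  by apply: leq_trans (leq_maxl _ _); rewrite index_mem.
rewrite invf_ple ?posrE//; apply: (le_trans (ltW (truncnS_gt _))).
by rewrite ler_nat ltnS leq_maxr.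
Qed.

(* If [q] vanishes on a compact set carrying the functionals at [ks], then
   [T q] is small on neighbourhoods of the points [ks i], so [`|q x| < 1] for
   every [x] normed by a sequence close to [ks].  The space of sequences being
   compact, a minimum of finitely many such [q] works for all sequences. *)
Let plateau_normed_by (F : set_system X) : ProperFilter F -> cluster F = set0 ->
  forall n, exists2 q : C, plateau F q &
    forall ks x, normed_by n ks x -> q x < 1.
Proof.
move=> FF F0 n.
have cKn : compact [set: {ptws nat -> K}].
  have := @tychonoff nat (fun _ => K) (fun _ => setT) (fun _ => cK).
  by congr (compact _); apply/seteqP; split.
pose P (A : set {ptws nat -> K}) := exists2 q : C, plateau F q &
    forall ks x, A ks -> normed_by n ks x -> q x < 1.
suff [q bq Hq] : P setT by exists q => // ks x; exact: Hq.
apply: compact_ideal cKn => //.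
- by have [q bq] := @plateau_cst1 R _ _ FF; exists q.
- by move=> A B AB [q bq Hq]; exists q => // ks x /AB; exact: Hq.
- move=> A B [q bq Hq] [q' bq' Hq'].
  have [p bp pq] := plateau_min FF bq bq'; exists p => // ks x ABx nx.
  have [pq1 pq2] := pq x.
  case: ABx => [/Hq|/Hq'] H; [exact: le_lt_trans pq1 (H _ nx)|].
  exact: le_lt_trans pq2 (H _ nx).
- move=> ks _.
  have [Q cQ TQ] : exists2 Q : set X, compact Q & forall f : C,
      (forall x, Q x -> f x = 0) -> forall i, (i < n)%N -> T f (ks i) = 0.
    elim: n {P} => [|n [Q cQ TQ]]; first by exists set0 => //; exact: compact0.
    have [Q' cQ' TQ'] := suppT (ks n).
    exists (Q `|` Q'); first exact: compactU.
    move=> f f0 i; rewrite ltnS leq_eqVlt => /predU1P[->|].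
      by apply: TQ' => x Q'x; apply: f0; right.
    by apply: TQ => x Qx; apply: f0; left.
  have [q bq q0] := @plateau_vanishing R X F FF crX F0 Q cQ.
  exists [set ks' : {ptws nat -> K} |
      forall i : 'I_n, `|T q (ks' i)| < n.+1%:R^-1].
    apply: (@filter_forall _ 'I_n (fun i ks' => `|T q (ks' i)| < n.+1%:R^-1)
      (nbhs ks)) => i.
    have ci :
        continuous ((fun ks' : {ptws nat -> K} => T q (ks' i)) : _ -> R^o).
      move=> ks'.
      apply: (@continuous_comp _ K R^o (fun u : {ptws nat -> K} => u i) (T q)).
        exact: (@proj_continuous nat (fun _ => K)).
      exact: ctsT.
    have /cvgrPdist_lt := ci ks.
    rewrite (TQ q q0 i)// => /(_ n.+1%:R^-1).
    rewrite invr_gt0 ltr0n => /(_ isT).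
    by apply: filterS => ks'; rewrite sub0r normrN.
  exists q => // ks' x Hks' nx.
  have : `|q x| < 1 by apply: nx => i ni; exact: (Hks' (Ordinal ni)).
  by apply: le_lt_trans; exact: ler_norm.
Qed.

(** The hypotheses say that the functionals [f |-> T f k] are continuous for the
    compact-open topology and that every evaluation at a point of [X] is
    continuous for the topology that they generate. *)
Lemma compact_of_norming : compact [set: X].
Proof.
move=> F FF _; apply: contrapT => /nonemptyPn; rewrite setTI => F0.
have /choice[q Hq] : forall n, exists q : C, plateau F q /\
    forall ks x, normed_by n ks x -> q x < 1.
  by move=> n; have [q bq nq] := plateau_normed_by FF F0 n; exists q.
have /choice[h hP] : forall n, exists h : C, forall x,
    h x != 0 <-> forall i, (i < n)%N -> 1 - n.+1%:R^-1 < q i x.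
  by move=> n; exact: superlevel_intersection.
apply: (@gliding_hump R X K T linT bndT injT suppT h).
- move=> n.
  have : F [set x | forall i : 'I_n, q i x = 1].
    apply: (@filter_forall _ 'I_n (fun i x => q i x = 1) F) => i.
    exact: (Hq i).1.2.
  move=> /filter_ex[x qx1]; exists x; apply/hP => i ni.
  by rewrite (qx1 (Ordinal ni)) ltrBlDr ltrDl invr_gt0 ltr0n.
(* near a point [x] normed by [n] points, [q n] stays below [(1 + q n x) / 2],
   which is less than [1 - 1 / (m + 1)] for all large [m] *)
- move=> x; have [n [ks nx]] := normed_by_some x.
  have qx1 := (Hq n).2 ks x nx.
  exists [set y | q n y < (1 + q n x) / 2].
    have /(_ [set t | t < (1 + q n x) / 2]) := @cts_fun _ _ (q n) x.
    by apply; apply: lt_nbhsl; lra.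
  pose d : R := (1 - q n x) / 2.
  have d0 : 0 < d by rewrite /d; lra.
  exists (maxn n.+1 (Num.truncn d^-1)) => m y.
  rewrite geq_max => /andP[nm dm] /= Uy.
  apply/eqP/negPn/negP => /hP /(_ n nm).
  have : m.+1%:R^-1 <= d.
    rewrite invf_ple ?posrE//; apply: (le_trans (ltW (truncnS_gt _))).
    by rewrite ler_nat ltnS.
  have absurd (a b c : R) : c <= (1 - a) / 2 -> 1 - c < b -> b < (1 + a) / 2 ->
    False by lra.
  by move=> md qy; exact: absurd md qy Uy.
Qed.

End norming.

(** * Neighbourhoods of zero in spaces of continuous functions *)

Section small_on.
Variables (R : realType) (X : Type) (B : set (set X)).
Hypotheses (B0 : B set0) (BU : forall P Q, B P -> B Q -> B (P `|` Q)).

(** The neighbourhoods of zero for uniform convergence on the members of [B].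
    With [B] the finite or the compact sets this describes pointwise or compact
    convergence. *)
Definition small_on : set_system (X -> R^o) :=
  filter_from [set p : set X * R | B p.1 /\ 0 < p.2]
    (fun p => [set g | forall x, p.1 x -> `|g x| < p.2]).

Lemma small_on_filter : Filter small_on.
Proof.
apply: filter_from_filter; first by exists (set0, 1) => /=; split.
move=> [P d] [Q e] /= [BP d0] [BQ e0]; exists (P `|` Q, Num.min d e).
  by split; [exact: BU|rewrite /= lt_min d0].
move=> g /= gs; split=> x xA.
  by have := gs x (or_introl xA); rewrite lt_min => /andP[].
by have := gs x (or_intror xA); rewrite lt_min => /andP[].
Qed.

End small_on.

Section nbhs_function_spaces.
Variables (R : realType) (X : topologicalType).

Lemma nbhs0_Ck (U : set (Ck R X)) : nbhs (0 : Ck R X) U ->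
  exists2 Q : set X, compact Q & exists2 e : R, 0 < e &
    forall h : Ck R X, (forall x, Q x -> `|h x| < e) -> U h.
Proof.
move=> [V [[W oW <-] W0 WU]].
have FF : Filter (small_on (R := R) (@compact X)).
  by apply: small_on_filter; [exact: compact0|exact: compactU].
have : small_on (R := R) (@compact X) -->
    ((0 : Ck R X) : {compact-open, X -> R^o}).
  apply/compact_open_cvgP => Q O cQ oO O0.
  have [[x Qx]|/nonemptyPn Q0] := pselect (Q !=set0); last first.
    by exists (Q, 1) => // g _ y [x Qx]; rewrite Q0 in Qx.
  have /nbhs_ballP[e /= e0 eO] : nbhs (0 : R^o) O.
    by apply: open_nbhs_nbhs; split=> //; apply: O0; exists x.
  exists (Q, e) => // g /= gs _ [y Qy <-]; apply: eO.
  by rewrite /ball /= sub0r normrN; exact: gs.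
have W0' : nbhs ((0 : Ck R X) : {compact-open, X -> R^o}) W.
  exact: open_nbhs_nbhs.
move=> cv; have [[Q e] /= [cQ e0] QeW] := cv W W0'.
by exists Q => //; exists e => // h hs; apply: WU; exact: QeW.
Qed.

Lemma nbhs0_Cp (U : set (Cp R X)) : nbhs (0 : Cp R X) U ->
  exists s : seq X, exists2 e : R, 0 < e &
    forall h : Cp R X, (forall x, x \in s -> `|h x| < e) -> U h.
Proof.
move=> [V [[W oW <-] W0 WU]].
have FF : Filter (small_on (R := R) (@finite_set X)).
  by apply: small_on_filter; [|move=> P Q; rewrite finite_setU].
have : small_on (R := R) (@finite_set X) --> ((0 : Cp R X) : {ptws X -> R^o}).
  apply/cvg_sup => x A [B [[W' oW' <-] W'0 W'A]].
  have /nbhs_ballP[e /= e0 eW'] : nbhs (0 : R^o) W'.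
    by apply: open_nbhs_nbhs; split.
  exists ([set x], e); first by split=> //=; exact: finite_set1.
  move=> g /= gs; apply: W'A; apply: eW'.
  by rewrite /ball /= sub0r normrN; exact: gs.
have W0' : nbhs ((0 : Cp R X) : {ptws X -> R^o}) W.
  exact: open_nbhs_nbhs.
move=> cv; have [[Q e] /= [+ e0] QeW] := cv W W0'.
move=> /finite_seqP[s Qs].
exists s; exists e => // h hs.
by apply: WU; apply: QeW => x; rewrite Qs; exact: hs.
Qed.

Lemma eval_Ck_continuous (x : X) :
  continuous ((fun h : Ck R X => h x) : _ -> R^o).
Proof.
apply/continuousP => O oO.
exists [set g : {compact-open, X -> R^o} | g @` [set x] `<=` O].
  by apply: compact_open_open => //; exact: compact_set1.
apply/seteqP; split=> h /= hx; last by move=> _ [_ -> <-].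
by apply: hx; exists x.
Qed.

Lemma eval_Cp_continuous (x : X) :
  continuous ((fun h : Cp R X => h x) : _ -> R^o).
Proof.
move=> h.
apply: (@continuous_comp (Cp R X) {ptws X -> R^o} R^o id (fun g => g x)).
  exact: initial_continuous.
exact: (@proj_continuous X (fun _ => R^o)).
Qed.

Lemma continuous_into_Cp (H : topologicalType) (T : H -> Cp R X) :
  (forall x, continuous ((fun h => T h x) : H -> R^o)) -> continuous T.
Proof.
move=> cT; apply: continuous_comp_initial => h; apply/cvg_sup => x.
apply: (@continuous_comp_initial _ H R^o (fun g : X -> R^o => g x)).
exact: cT.
Qed.

End nbhs_function_spaces.

(** * Linearly Eberlein-Grothendieck function spaces have compact domain *)

(** Here [H] is [C(X)] with a topology coarser than the compact-open one and
    finer than the pointwise one; the map [j] stands for the identity and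
    allows the two topologies on [C(X)] to be treated at once.  Continuity of
    the embedding at zero confines each functional [f |-> T (j f) k] to a
    compact set, and continuity of its inverse at zero bounds each evaluation
    by the values of [T (j f)] at finitely many points. *)
Lemma compact_of_linearly_EG (R : realType) (X : topologicalType)
    (H : preTopologicalLmodType R) (j : Ck R X -> H) :
  completely_regular_space X ->
  (forall a f g, j (a *: f + g) = a *: j f + j g) -> continuous j ->
  (forall x, exists2 ev : H -> R^o, continuous ev &
     forall f : Ck R X, ev (j f) = f x) ->
  linearly_Eberlein_Grothendieck H -> compact [set: X].
Proof.
move=> crX linj cj evH [K [_ cK [L [T [_ [S [LT TS _ cT cS]]]]]]].
have linTj a f g : T (j (a *: f + g)) = a *: T (j f) + T (j g).
  by rewrite linj linearP.
have Z f a : j (a *: f) = a *: j f + j 0 by rewrite -linj addr0.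
have j0 : j 0 = 0.
  by have := linj (-1) 0 0; rewrite scaler0 addr0 scaleN1r addNr.
apply: (@compact_of_norming R X K (fun f k => T (j f) k)) => //.
- by move=> a f g k; rewrite linTj.
- by move=> f; exact: cts_fun.
- move=> k.
  have ck : continuous ((fun f => T (j f) k) : Ck R X -> R^o).
    move=> f.
    apply: (@continuous_comp (Ck R X) (Cp R K) R^o (T \o j) (fun g => g k)).
      by apply: continuous_comp; [exact: cj|exact: cT].
    exact: eval_Cp_continuous.
  have /cvgrPdist_lt/(_ 1 ltr01)/nbhs0_Ck[Q cQ [e e0 He]] := ck 0.
  exists Q => // f f0; apply/eqP/negPn/negP => Tf0.
  (* this multiple of [f] also vanishes on [Q], but has the value [1] at [k] *)
  have := He ((T (j f) k)^-1 *: f).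
  rewrite Z !j0 addr0 linearZ linear0.
  have -> : `|(0 : Cp R K) k - ((T (j f) k)^-1 *: T (j f)) k| = 1.
    rewrite -[X in `|X|]/(0 - (T (j f) k)^-1 * T (j f) k).
    by rewrite mulVf// sub0r normrN normr1.
  rewrite ltxx => Habs; apply: (notF (Habs _)) => x Qx.
  by rewrite -[X in `|X|]/((T (j f) k)^-1 * f x) f0// mulr0 normr0.
- move=> x; have [ev cev evj] := evH x.
  have ev0 : ev 0 = 0 by rewrite -j0 evj.
  have S0 : S 0 = 0 by rewrite -(linear0 T) TS.
  have L0 : L 0 by rewrite -(linear0 T).
  have nV : nbhs (S 0) [set h | `|ev h| < 1].
    rewrite S0; have /cvgrPdist_lt/(_ 1 ltr01) := cev 0.
    by apply: filterS => h; rewrite ev0 sub0r normrN.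
  have := cS 0 _ nV.
  rewrite nbhs_simpl /= {1}/nbhs /= -nbhs_subspace_in//.
  move=> /nbhs0_Cp[s [e e0 He]].
  exists s, e => // f fs; rewrite -evj.
  by have := He (T (j f)) fs (LT _); rewrite /= /from_subspace TS.
Qed.

Lemma compact_of_Cp_linearly_EG (R : realType) (X : topologicalType) :
  completely_regular_space X ->
  linearly_Eberlein_Grothendieck (Cp R X) -> compact [set: X].
Proof.
move=> crX; apply: (@compact_of_linearly_EG R X (Cp R X) id) => //.
  by apply: continuous_into_Cp => x; exact: eval_Ck_continuous.
by move=> x; exists (fun h : Cp R X => h x) => //; exact: eval_Cp_continuous.
Qed.

Lemma continuous_id_weak (R : realType) (E : preTopologicalLmodType R) :
  continuous (id : E -> weak E).
Proof.
move=> h; apply/cvg_sup => f.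
apply: (@continuous_comp_initial E E R^o (sval f)).
exact: (svalP f).
Qed.

Lemma continuous_dual_weak (R : realType) (E : preTopologicalLmodType R)
  (f : dual E) : continuous ((sval f : E -> R^o) : weak E -> R^o).
Proof.
move=> h; have : nbhs (h : weak E) --> (h : weak E) by exact: cvg_id.
move/cvg_sup => /(_ f) cv.
apply: cvg_trans (@initial_continuous E R^o (sval f) h).
exact: cvg_app cv.
Qed.

Lemma compact_of_weak_Ck_linearly_EG (R : realType) (X : topologicalType) :
  completely_regular_space X ->
  linearly_Eberlein_Grothendieck (weak (Ck R X)) -> compact [set: X].
Proof.
move=> crX.
apply: (@compact_of_linearly_EG R X (weak (Ck R X)) id) => //.
  exact: continuous_id_weak.
move=> x.
pose ev : Ck R X -> R^o := fun h => h x.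
have lin_ev : linear ev by [].
pose evL : {linear Ck R X -> R^o} :=
  HB.pack ev (GRing.isLinear.Build _ _ _ _ ev lin_ev).
have cev : continuous evL by exact: eval_Ck_continuous.
exists ev => //; exact: (@continuous_dual_weak R (Ck R X) (exist _ evL cev)).
Qed.

(** * Function spaces over a compact space *)

Lemma compact_set_type (T : topologicalType) (A : set T) :
  compact A -> compact [set: set_type A].
Proof.
move=> cA F FF _.
have [x [Ax clx]] : A `&` cluster ((val : set_type A -> T) @ F) !=set0.
  apply: (cA _ (fmap_proper_filter _ FF)).
  by apply: (@filterS _ F _ setT) => [y _|]; [exact: set_valP|exact: filterT].
exists (SigSub (mem_set Ax)); split=> // B U FB [V [[W oW <-] Wx VU]].
have FvB : F (val @^-1` (val @` B)) by apply: filterS FB => y By; exists y.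
have [_ [[y By <-] Wy]] := clx _ W FvB (open_nbhs_nbhs (conj oW Wx)).
by exists y; split=> //; exact: VU.
Qed.

Lemma hausdorff_set_type (T : topologicalType) (A : set T) :
  hausdorff_space T -> hausdorff_space (set_type A).
Proof.
move=> hT p q clpq; apply: val_inj; apply: hT => U V Up Vq.
have cval := @initial_continuous (set_type A) T val.
have [r [Ur Vr]] := clpq _ _ (cval p U Up) (cval q V Vq).
by exists (val r).
Qed.

Lemma compact_hausdorff_tychonoff (R : realType) (K : topologicalType) :
  hausdorff_space K -> compact [set: K] -> tychonoff_space K.
Proof.
move=> hK cK; split=> //; apply: (@normal_completely_regular R).
  exact: compact_normal.
exact: hausdorff_accessible.
Qed.

Lemma Cp_linearly_EG_of_compact (R : realType) (X : topologicalType) :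
  tychonoff_space X -> compact [set: X] ->
  linearly_Eberlein_Grothendieck (Cp R X).
Proof.
move=> tX cX; exists X; split=> //.
have lin_id : linear (id : Cp R X -> Cp R X) by [].
pose T : {linear Cp R X -> Cp R X} := HB.pack (id : Cp R X -> Cp R X)
  (GRing.isLinear.Build _ _ _ _ _ lin_id).
exists setT, T; split.
  by split=> [|a f g _ _]; rewrite inE.
have cid : continuous (id : Cp R X -> Cp R X) by move=> f; exact: cvg_id.
by exists id; split => //; exact: continuous_subspaceT.
Qed.

Section dual_ball.
Variables (R : realType) (X : topologicalType).
Hypothesis cX : compact [set: X].
Local Notation E := (Ck R X).

Lemma nbhs_Ck_sup (f : E) (e : R) : 0 < e ->
  nbhs f [set g : E | forall x, `|f x - g x| < e].
Proof.
move=> e0.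
have cv : nbhs (f : {compact-open, X -> R^o}) -->
    (f : {compact-open, X -> R^o}).
  exact: cvg_id.
move: cv; move=> /(@compact_open_fam_compactP X R^o f _ (@cts_fun _ _ f) _).
move=> /cvg_sup /(_ (existT _ [set: X] cX)) cv.
have := cv [set g | forall x, `|f x - g x| < e].
have H : nbhs (f : {uniform` [set: X] -> R^o})
    [set g | forall x, `|f x - g x| < e].
  apply/uniform_nbhs; exists [set xy | `|xy.1 - xy.2| < e]; split.
    by rewrite -entourage_ballE; exists e.
  by move=> g Hg x; exact: Hg.
move=> /(_ H) nf.
have := @initial_continuous (continuousType X R^o) {compact-open, X -> R^o}
  (id : continuousType X R^o -> {compact-open, X -> R^o}) f.
by move=> /(_ _ nf).
Qed.

(** When [X] is compact this is the unit ball for the dual of the supremum norm,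
    described by the bounds [M] of [f] and without naming a norm; the
    requirement [0 < M] keeps the definition sensible for an empty [X]. *)
Definition dual_ball : set {ptws E -> R^o} :=
  [set phi : E -> R |
    (forall (a : R) (f g : E), phi (a *: f + g) = a * phi f + phi g) /\
    forall (f : E) (M : R), 0 < M -> (forall x, `|f x| <= M) -> `|phi f| <= M].

End dual_ball.

Section closed_conditions.
Variables (R : realType) (T : topologicalType).

Lemma closed_eq_affine (a : R) (f g h : T -> R^o) :
  continuous f -> continuous g -> continuous h ->
  closed [set x | f x = a * g x + h x].
Proof.
move=> cf cg ch.
have -> : [set x | f x = a * g x + h x] =
    (fun x => f x - (a * g x + h x)) @^-1` [set 0 : R^o].
  by apply/seteqP; split=> x /=; [move=> ->; rewrite subrr|move/subr0_eq].
apply: preimage_closed; last exact: closed_eq.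
move=> x _; apply: cvgB; first exact: cf.
by apply: cvgD; [apply: cvgM; [exact: cvg_cst|exact: cg]|exact: ch].
Qed.

Lemma closed_norm_le (M : R) (f : T -> R^o) :
  continuous f -> closed [set x | `|f x| <= M].
Proof.
move=> cf; apply: (@preimage_closed T R^o (fun x => `|f x|) [set t | t <= M]).
  by move=> x _; apply: cvg_norm; exact: cf.
exact: closed_le.
Qed.

End closed_conditions.

Section dual_ball_compact.
Variables (R : realType) (X : topologicalType).
Hypothesis cX : compact [set: X].
Local Notation E := (Ck R X).
Local Notation dual_ball := (@dual_ball R X).

(** Banach-Alaoglu: the ball is closed, for pointwise convergence, in a product
    of segments. *)
Lemma compact_dual_ball : compact dual_ball.
Proof.
have cev (f : E) : continuous (fun phi : {ptws E -> R^o} => phi f).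
  exact: (@proj_continuous E (fun _ => R^o)).
have bnd (f : E) : exists M : R, 0 < M /\ forall x, `|f x| <= M.
  have [M M0 HM] := continuous_bounded_on_compact cX (@cts_fun _ _ f).
  by exists M.
have /choice[M HM] := bnd.
have cbox := @tychonoff E (fun _ => R^o) (fun f => `[- M f, M f]%classic)
  (fun f => @segment_compact R (- M f) (M f)).
apply: subclosed_compact cbox _; last first.
  move=> phi [_ phiM] f; rewrite /= in_itv /= -ler_norml.
  by apply: phiM; have [] := HM f.
have -> : dual_ball =
  \bigcap_(u : R * E * E)
    [set phi : {ptws E -> R^o} |
       phi (u.1.1 *: u.1.2 + u.2) = u.1.1 * phi u.1.2 + phi u.2] `&`
  \bigcap_(u in [set u : E * R | 0 < u.2 /\ forall x, `|u.1 x| <= u.2])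
    [set phi : {ptws E -> R^o} | `|phi u.1| <= u.2].
  apply/seteqP; split=> phi.
    move=> [phil phiM]; split=> [[[a f] g] _|[f m] [m0 fm]] /=.
      exact: phil.
    exact: phiM.
  move=> [phil phiM]; split=> [a f g|f m m0 fm].
    exact: (phil (a, f, g)).
  exact: (phiM (f, m)).
apply: closedI; apply: closed_bigI => u _.
  exact: (closed_eq_affine (a := u.1.1) (cev (u.1.1 *: u.1.2 + u.2)) (cev u.1.2)
    (cev u.2)).
exact: (closed_norm_le (M := u.2) (cev u.1)).
Qed.

End dual_ball_compact.

Section weak_embedding.
Variables (R : realType) (X : topologicalType).
Hypothesis cX : compact [set: X].
Local Notation E := (Ck R X).
Local Notation K := (set_type (@dual_ball R X)).

Lemma dual_ball_continuous (phi : E -> R^o) : dual_ball phi -> continuous phi.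
Proof.
move=> [phil phiM] f.
apply/(@cvgrPdist_lt R R^o E (nbhs f) (nbhs_filter f)) => e e0.
have e20 : 0 < e / 2 by rewrite divr_gt0.
have := nbhs_Ck_sup cX f e20.
apply: (@filterS _ _ (nbhs_filter (f : E))) => g fg.
have := phil (-1) g f.
rewrite scaleN1r mulN1r [- g + f]addrC [- phi g + _]addrC => <-.
apply: (@le_lt_trans _ _ (e / 2)); last by lra.
by apply: phiM => // x; exact: ltW (fg x).
Qed.

Lemma dual_ball_absorbs (psi : dual E) : exists2 e : R, 0 < e &
  dual_ball (fun f => e * sval psi f).
Proof.
case: psi => psi cpsi /=.
have /cvgrPdist_lt/(_ 1 ltr01)/nbhs0_Ck[Q _ [e e0 He]] := cpsi 0.
have e20 : 0 < e / 2 by rewrite divr_gt0.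
exists (e / 2) => //; split=> [a f g|f M M0 fM].
  by rewrite linearP mulrDr mulrCA.
have := He ((e / 2 / M) *: f); rewrite linear0 sub0r normrN linearZ.
rewrite -[X in `|X|]/(e / 2 / M * psi f).
have -> : e / 2 / M * psi f = (e / 2 * psi f) / M by rewrite mulrAC.
rewrite normrM normfV (gtr0_norm M0) ltr_pdivrMr// mul1r => H.
apply/ltW/H => x _; rewrite -[X in `|X|]/(e / 2 / M * f x).
rewrite normrM (@ger0_norm _ (e / 2 / M)); last by rewrite divr_ge0// ltW.
apply: (@le_lt_trans _ _ (e / 2)); last by lra.
by rewrite -ler_pdivlMl ?divr_gt0// invf_div divfK ?gt_eqF// fM.
Qed.

Lemma eval_dual_ball (x : X) : dual_ball ((fun f : E => f x) : {ptws E -> R^o}).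
Proof. by split=> // f M _; apply. Qed.

Lemma eval_K_continuous (f : E) :
  continuous ((fun k : K => val k f) : K -> R^o).
Proof.
move=> k.
apply: (@continuous_comp K {ptws E -> R^o} R^o val (fun phi => phi f)).
  exact: initial_continuous.
exact: (@proj_continuous E (fun _ => R^o)).
Qed.

(** The canonical map of [C(X)] into its bidual, restricted to the dual ball. *)
Definition dual_eval (f : weak E) : Cp R K := mkcts (@eval_K_continuous f).

Lemma dual_eval_linear : linear dual_eval.
Proof.
move=> a f g; apply/continuousEP => k.
by have [phil _] := set_valP k; exact: phil.
Qed.

HB.instance Definition _ :=
  GRing.isLinear.Build _ _ _ _ dual_eval dual_eval_linear.

(** Points of [C(X)] are separated by the ball because it contains the
    evaluations. *)
Lemma dual_eval_inj : injective dual_eval.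
Proof.
move=> f g fg; apply/continuousEP => x.
exact: (congr1 (fun h : Cp R K => h (SigSub (mem_set (eval_dual_ball x)))) fg).
Qed.

Lemma dual_eval_continuous : continuous dual_eval.
Proof.
apply: continuous_into_Cp => k.
have [phil _] := set_valP k.
pose phi : {linear E -> R^o} := HB.pack (val k : E -> R^o)
  (GRing.isLinear.Build _ _ _ _ (val k : E -> R^o) phil).
have cphi : continuous phi by exact: dual_ball_continuous (set_valP k).
exact: (@continuous_dual_weak R E (exist _ phi cphi)).
Qed.

(** The inverse of the embedding is weakly continuous because every [psi] in the
    dual has a positive multiple [phi] in the ball: on the image, [psi] of the
    inverse is a multiple of evaluation at [phi]. *)
Lemma weak_Ck_linearly_EG_of_compact :
  linearly_Eberlein_Grothendieck (weak E).
Proof.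
have cK : compact [set: K] := compact_set_type (compact_dual_ball cX).
exists K; split=> //.
  apply: (compact_hausdorff_tychonoff R) cK; apply: hausdorff_set_type.
  by apply: (@hausdorff_product E (fun _ => R^o)) => _; exact: norm_hausdorff.
exists (range dual_eval), dual_eval; split.
  split=> [|a f g]; first by rewrite inE; exists 0 => //; rewrite linear0.
  rewrite !inE => -[f' _ <-] [g' _ <-].
  by exists (a *: f' + g') => //; rewrite linearP.
pose S (g : Cp R K) : weak E := xget 0 [set f | dual_eval f = g].
have SK f : S (dual_eval f) = f.
  by rewrite /S; case: xgetP => [g _ /dual_eval_inj//|/(_ f)]; case.
exists S; split=> //.
- by move=> g; rewrite inE => -[f _ <-]; rewrite SK.
- exact: dual_eval_continuous.
move=> g; apply/cvg_sup => psi.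
apply: (@continuous_comp_initial E (subspace (range dual_eval)) R^o
  (sval psi) S).
have [e e0 psiB] := dual_ball_absorbs psi.
pose phi : K := SigSub (mem_set psiB).
apply: (@subspace_eq_continuous _ _ _ (fun h : Cp R K => e^-1 * h phi)).
  move=> h; rewrite inE => -[f _ <-] /=.
  by rewrite SK -[dual_eval f phi]/(e * sval psi f) mulKf// gt_eqF.
apply: continuous_subspaceT => h.
apply: (@continuous_comp (Cp R K) R^o R^o (fun h => h phi) ( *%R e^-1)).
  exact: eval_Cp_continuous.
exact: mulrl_continuous.
Qed.

End weak_embedding.

(** * The characterization *)

Theorem theorem3p11 (R : realType) (X : topologicalType)
    (tychonoffX : tychonoff_space X) :
  (compact [set: X] <-> linearly_Eberlein_Grothendieck (Cp R X)) /\
  (compact [set: X] <-> linearly_Eberlein_Grothendieck (weak (Ck R X))).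
Proof.
have crX := tychonoffX.2.
split; split.
- exact: Cp_linearly_EG_of_compact.
- exact: compact_of_Cp_linearly_EG.
- exact: weak_Ck_linearly_EG_of_compact.
- exact: compact_of_weak_Ck_linearly_EG.
Qed.
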